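(* Let $\Omega\subseteq\mathbb R^d$ be open and let $P^*(x,\partial)=\sum_{|\alpha|\le m}c_\alpha(x)\,\partial^\alpha:\mathcal D^*(\Omega)\to\mathcal D^*(\Omega)$ be a linear partial differential operator with coefficients $c_\alpha\in\mathcal C^\infty(\Omega)$ which is regular. Then the equation $P^*(x,\partial)U=T$ is solvable in $\mathcal D^*(\Omega)$: for every $T\in\mathcal D^*(\Omega)$ there exists $U\in\mathcal D^*(\Omega)$ such that $P^*(x,\partial)U=T$.
   Context: $\mathcal E(\Omega)=\mathcal C^\infty(\Omega)$ is the space of smooth functions $\Omega\to\mathbb C$, and $\mathcal D(\Omega)=\mathcal C_0^\infty(\Omega)$ is the $\mathbb C$-vector space of smooth functions $\Omega\to\mathbb C$ with compact support. $\mathcal D^*(\Omega)$ is the algebraic dual of $\mathcal D(\Omega)$ (all $\mathbb C$-linear functionals, no continuity required), and $\langle T,\varphi\rangle$ denotes the value of $T\in\mathcal D^*(\Omega)$ at $\varphi\in\mathcal D(\Omega)$. For $f\in\mathcal E(\Omega)$ and $T\in\mathcal D^*(\Omega)$, the product $fT\in\mathcal D^*(\Omega)$ is defined by $\langle fT,\varphi\rangle=\langle T,f\varphi\rangle$. For a multi-index $\alpha\in\mathbb N_0^d$, $\partial^\alpha T\in\mathcal D^*(\Omega)$ is defined by $\langle\partial^\alpha T,\varphi\rangle=(-1)^{|\alpha|}\langle T,\partial^\alpha\varphi\rangle$. Regular: a linear operator $\mathcal O^*$ on the algebraic dual $V^*$ of a vector space $V$ is called regular if there is an injective linear operator $\mathcal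 O:V\to V$ (the co-dual of $\mathcal O^*$) such that $\mathcal O^*(T)=T\circ\mathcal O$ for all $T\in V^*$. For $V=\mathcal D(\Omega)$ and $P^*(x,\partial)=\sum_{|\alpha|\le m}c_\alpha\partial^\alpha$ the co-dual operator is $P(x,\partial):\mathcal D(\Omega)\to\mathcal D(\Omega)$, $P(x,\partial)\varphi=\sum_{|\alpha|\le m}(-1)^{|\alpha|}\partial^\alpha(c_\alpha\varphi)$, so $P^*(x,\partial)$ being regular means that $P(x,\partial)$ is injective on $\mathcal D(\Omega)$. *)

(* Defs.v *)
From HB Require Import structures.
From mathcomp Require Import all_boot all_order all_algebra complex.
From mathcomp Require Import boolp classical_sets functions reals topology.
From mathcomp Require Import prodnormedzmodule normedtype derive.

Set Implicit Arguments.
Unset Strict Implicit.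
Unset Printing Implicit Defensive.

Import Order.TTheory GRing.Theory Num.Theory.
Import numFieldNormedType.Exports.

Local Open Scope classical_set_scope.
Local Open Scope ring_scope.

Section AlgebraicDual.
Context {K : fieldType} (V : lmodType K).

Definition dual : Type := {linear V -> K^o}.

Implicit Types S T U : dual.

Lemma dualP S T : (forall v, S v = T v) -> S = T.
Proof.
case: S => s [[sm] [ss]]; case: T => t [[tm] [ts]] /= /funext st.
have {st} st : s = t by [].
case: _ / st tm ts => tm ts.
by rewrite (Prop_irrelevance sm tm) (Prop_irrelevance ss ts).
Qed.

Definition dual_zero : dual := \0.
Definition dual_opp T : dual := \- T.
Definition dual_add S T : dual := S \+ T.
Definition dual_scale (a : K) T : dual := a \*: T.

Lemma dual_addA : associative dual_add.
Proof. by move=> S T U; apply: dualP => v; rewrite /= addrA. Qed.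
Lemma dual_addC : commutative dual_add.
Proof. by move=> S T; apply: dualP => v; rewrite /= addrC. Qed.
Lemma dual_add0 : left_id dual_zero dual_add.
Proof. by move=> T; apply: dualP => v; rewrite /= add0r. Qed.
Lemma dual_addN : left_inverse dual_zero dual_opp dual_add.
Proof. by move=> T; apply: dualP => v; rewrite /= addNr. Qed.

HB.instance Definition _ := Choice.on dual.
HB.instance Definition _ :=
  GRing.isZmodule.Build dual dual_addA dual_addC dual_add0 dual_addN.

Lemma dual_scaleA a b T : dual_scale a (dual_scale b T) = dual_scale (a * b) T.
Proof. by apply: dualP => v; rewrite /= scalerA. Qed.
Lemma dual_scale1 : left_id 1 dual_scale.
Proof. by move=> T; apply: dualP => v; rewrite /= scale1r. Qed.
Lemma dual_scaleDr : right_distributive dual_scale +%R.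
Proof. by move=> a S T; apply: dualP => v; rewrite /= scalerDr. Qed.
Lemma dual_scaleDl T : {morph dual_scale^~ T : a b / a + b}.
Proof. by move=> a b; apply: dualP => v; rewrite /= scalerDl. Qed.

HB.instance Definition _ := GRing.Zmodule_isLmodule.Build K dual
  dual_scaleA dual_scale1 dual_scaleDr dual_scaleDl.

End AlgebraicDual.

Definition regular {K : fieldType} {V : lmodType K}
    (Ostar : {linear dual V -> dual V}) : Prop :=
  exists2 O : {linear V -> V},
    injective O & forall T : dual V, Ostar T = (T \o O : dual V).

Section Smooth.
Context {R : realType} {d : nat}.
Local Notation E := 'rV[R]_d.

Record openset := OpenSet { oset :> set E; oset_open : open oset }.

Definition ebase (i : 'I_d) : E := delta_mx 0 i.

(* Functions on Omega are encoded as total functions on R^d; since Omega is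
   open, continuity and derivability at points of Omega, and the values there
   of the partial derivatives, do not depend on the values off Omega. *)
Fixpoint Ck (Omega : set E) (k : nat) (f : E -> R) : Prop :=
  (forall x, Omega x -> {for x, continuous f}) /\
  if k is k'.+1 then
    forall i, (forall x, Omega x -> derivable f x (ebase i)) /\
              Ck Omega k' ('D_(ebase i) f)
  else True.

(* R[i] has no structure of normed space over R in the library, so smoothness
   and partial derivatives of complex-valued functions go through the real and
   imaginary parts. *)
Definition smooth (Omega : set E) (f : E -> R[i]) : Prop :=
  forall k, Ck Omega k (fun x => complex.Re (f x)) /\
            Ck Omega k (fun x => complex.Im (f x)).

Definition pderiv (i : 'I_d) (f : E -> R[i]) : E -> R[i] := fun x =>
  ('D_(ebase i) (fun y => complex.Re (f y)) x +i*
   'D_(ebase i) (fun y => complex.Im (f y)) x)%C.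

Definition supp (f : E -> R[i]) : set E := closure [set x | f x != 0].

End Smooth.
Arguments openset : clear implicits.

Section SmoothTheory.
Context {R : realType} {d : nat} (Omega : openset R d).
Local Notation E := 'rV[R]_d.

Lemma near_oset x : oset Omega x -> \forall y \near x, oset Omega y.
Proof. by move=> Ox; apply: open_nbhs_nbhs; split=> //; exact: oset_open. Qed.

Lemma eq_near_oset T (f g : E -> T) :
  (forall x, oset Omega x -> f x = g x) ->
  forall x, oset Omega x -> \forall y \near x, f y = g y.
Proof. by move=> fg x /near_oset; apply: filterS => y /fg. Qed.

Lemma eq_for_continuous (f g : E -> R) x :
  (forall y, oset Omega y -> f y = g y) -> oset Omega x ->
  {for x, continuous f} -> {for x, continuous g}.
Proof.
move=> fg Ox cf; rewrite /prop_for /continuous_at -fg//.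
have fgx := @near_eq_cvg _ _ (nbhs x) _ f g (eq_near_oset fg Ox).
exact: (cvg_trans (fgx _) cf).
Qed.

Lemma eq_Ck k (f g : E -> R) :
  (forall x, oset Omega x -> f x = g x) -> Ck Omega k f -> Ck Omega k g.
Proof.
elim: k f g => [|k IHk] f g fg [cf df]; have nfg := eq_near_oset fg.
  by split=> // x Ox; apply: eq_for_continuous (cf _ Ox).
split=> [x Ox|i]; first exact: eq_for_continuous (cf _ Ox).
have [dfi Cf] := df i; split=> [x Ox|].
  exact: near_eq_derivable (nfg _ Ox) (dfi _ Ox).
by apply: IHk Cf => x Ox; apply: near_eq_derive; apply: nfg.
Qed.

Lemma CkW k (f : E -> R) : Ck Omega k.+1 f -> Ck Omega k f.
Proof.
elim: k f => [|k IHk] f [cf df]; split=> // i.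
by have [dfi Cf] := df i; split=> //; apply: IHk.
Qed.

Lemma Ck_cst k (a : R) : Ck Omega k (fun=> a).
Proof.
have ca x : oset Omega x -> {for x, continuous (fun=> a : R)}.
  by move=> _; apply: cst_continuous.
elim: k a ca => [|k IHk] a ca; split=> // i.
split=> [x _|]; first exact: derivable_cst.
apply: eq_Ck (IHk 0 _) => x _; first by rewrite derive_cst.
exact: cst_continuous.
Qed.

Lemma CkD k (f g : E -> R) :
  Ck Omega k f -> Ck Omega k g -> Ck Omega k (fun x => f x + g x).
Proof.
elim: k f g => [|k IHk] f g [cf df] [cg dg]; split=> //.
- by move=> x Ox; apply: (cvgD (cf _ Ox) (cg _ Ox)).
- by move=> x Ox; apply: (cvgD (cf _ Ox) (cg _ Ox)).
move=> i; have [dfi Cf] := df i; have [dgi Cg] := dg i.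
split=> [x Ox|]; first exact: derivableD (dfi _ Ox) (dgi _ Ox).
apply: eq_Ck (IHk _ _ Cf Cg) => x Ox; apply/esym.
exact: deriveD (dfi _ Ox) (dgi _ Ox).
Qed.

Lemma CkM k (f g : E -> R) :
  Ck Omega k f -> Ck Omega k g -> Ck Omega k (fun x => f x * g x).
Proof.
elim: k f g => [|k IHk] f g Cf0 Cg0; case: (Cf0) (Cg0) => [cf df] [cg dg].
  by split=> // x Ox; apply: (cvgM (cf _ Ox) (cg _ Ox)).
split=> [x Ox|i]; first by apply: (cvgM (cf _ Ox) (cg _ Ox)).
have [dfi Cf] := df i; have [dgi Cg] := dg i.
split=> [x Ox|]; first exact: derivableM (dfi _ Ox) (dgi _ Ox).
apply: eq_Ck (CkD (IHk _ _ (CkW Cf0) Cg) (IHk _ _ (CkW Cg0) Cf)) => x Ox.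
by apply/esym; apply: deriveM (dfi _ Ox) (dgi _ Ox).
Qed.

Lemma CkN k (f : E -> R) : Ck Omega k f -> Ck Omega k (fun x => - f x).
Proof.
move=> Cf; apply: eq_Ck (CkM (Ck_cst k (-1)) Cf) => x _.
by rewrite mulN1r.
Qed.

Lemma ReM (z w : R[i]) : complex.Re (z * w) =
  complex.Re z * complex.Re w + - (complex.Im z * complex.Im w).
Proof. by case: z w => [a b] [a' b']. Qed.
Lemma ImM (z w : R[i]) : complex.Im (z * w) =
  complex.Re z * complex.Im w + complex.Im z * complex.Re w.
Proof. by case: z w => [a b] [a' b']. Qed.

Lemma smooth_cst (a : R[i]) : smooth Omega (fun=> a).
Proof. by move=> k; split; apply: Ck_cst. Qed.

Lemma smoothD (f g : E -> R[i]) : smooth Omega f -> smooth Omega g ->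
  smooth Omega (fun x => f x + g x).
Proof.
move=> sf sg k; have [f1 f2] := sf k; have [g1 g2] := sg k.
by split; [apply: eq_Ck (CkD f1 g1) => x _|apply: eq_Ck (CkD f2 g2) => x _];
  case: (f x) (g x) => [? ?] [? ?].
Qed.

Lemma smoothM (f g : E -> R[i]) : smooth Omega f -> smooth Omega g ->
  smooth Omega (fun x => f x * g x).
Proof.
move=> sf sg k; have [f1 f2] := sf k; have [g1 g2] := sg k.
split.
  by apply: eq_Ck (CkD (CkM f1 g1) (CkN (CkM f2 g2))) => x _; rewrite ReM.
by apply: eq_Ck (CkD (CkM f1 g2) (CkM f2 g1)) => x _; rewrite ImM.
Qed.

Lemma smooth_pderiv i (f : E -> R[i]) :
  smooth Omega f -> smooth Omega (pderiv i f).
Proof.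
move=> sf k; have [[_ f1] [_ f2]] := sf k.+1.
by split; [apply: (f1 i).2|apply: (f2 i).2].
Qed.

Lemma smooth_derivable (f : E -> R[i]) i x : smooth Omega f -> oset Omega x ->
  derivable (fun y => complex.Re (f y)) x (ebase i) /\
  derivable (fun y => complex.Im (f y)) x (ebase i).
Proof.
move=> sf Ox; have [[_ f1] [_ f2]] := sf 1.
by split; [apply: (f1 i).1|apply: (f2 i).1].
Qed.

Lemma notin_supp (f : E -> R[i]) x : ~ supp f x -> \forall y \near x, f y = 0.
Proof.
move=> nfx; have : open (~` supp f) by apply/closed_openC/closed_closure.
move=> onfx; have := open_nbhs_nbhs (conj onfx nfx); apply: filterS => y nfy.
by apply: contrapT => /eqP fy; apply: nfy; apply: subset_closure.
Qed.

Lemma supp_eq0 (f : E -> R[i]) x : ~ supp f x -> f x = 0.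
Proof. by move/notin_supp/nbhs_singleton. Qed.

Lemma sub_supp (f : E -> R[i]) (A : set E) : closed A ->
  (forall x, ~ A x -> f x = 0) -> supp f `<=` A.
Proof.
move=> clA fA; rewrite /supp (closure_id A).1//; apply: closureS => x /= /eqP fx.
by apply: contrapT => /fA.
Qed.

Lemma pderiv_notin_supp i (f : E -> R[i]) x : ~ supp f x -> pderiv i f x = 0.
Proof.
move=> /notin_supp f0; rewrite /pderiv.
rewrite (@near_eq_derive _ _ _ _ (fun=> 0 : R)); last first.
  by apply: filterS f0 => y ->.
rewrite (@near_eq_derive _ _ _ (fun y => complex.Im _) (fun=> 0 : R)); last first.
  by apply: filterS f0 => y ->.
by rewrite derive_cst.
Qed.

Lemma derive_lin3 (u v w : E -> R) (a b : R) x e :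
  derivable u x e -> derivable v x e -> derivable w x e ->
  'D_e (fun y => a * u y + b * v y + w y) x =
  a * 'D_e u x + b * 'D_e v x + 'D_e w x.
Proof.
move=> du dv dw.
have dau := @derivableZ _ _ _ _ a _ _ du.
have dbv := @derivableZ _ _ _ _ b _ _ dv.
have dab := derivableD dau dbv.
by rewrite (deriveD dab dw) (deriveD dau dbv) !deriveZ.
Qed.

Lemma pderiv_linear i (a : R[i]) (f g : E -> R[i]) x :
  derivable (fun y => complex.Re (f y)) x (ebase i) ->
  derivable (fun y => complex.Im (f y)) x (ebase i) ->
  derivable (fun y => complex.Re (g y)) x (ebase i) ->
  derivable (fun y => complex.Im (g y)) x (ebase i) ->
  pderiv i (fun y => a * f y + g y) x = a * pderiv i f x + pderiv i g x.
Proof.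
case: a => a b f1 f2 g1 g2; rewrite /pderiv.
have -> : (fun y => complex.Re (Complex a b * f y + g y)) = (fun y =>
    a * complex.Re (f y) + - b * complex.Im (f y) + complex.Re (g y)).
  by apply/funext => y; case: (f y) (g y) => [p q] [r t]; rewrite /= mulNr.
have -> : (fun y => complex.Im (Complex a b * f y + g y)) = (fun y =>
    a * complex.Im (f y) + b * complex.Re (f y) + complex.Im (g y)).
  by apply/funext => y; case: (f y) (g y) => [p q] [r t].
rewrite (derive_lin3 _ _ f1 f2 g1) (derive_lin3 _ _ f2 f1 g2) mulNr.
reflexivity.
Qed.

End SmoothTheory.

(* The values of a smoothfun off Omega are irrelevant: it only ever acts by
   multiplication on functions supported in Omega. *)
Record smoothfun {R : realType} {d : nat} (Omega : openset R d) := SmoothFun {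
  smoothfun_val :> 'rV[R]_d -> R[i];
  smoothfunP : smooth Omega smoothfun_val }.

(* A compactly supported function on Omega is encoded by its extension by zero
   to R^d; the encoding is one-to-one because the support lies in Omega. *)
Definition is_test {R : realType} {d : nat} (Omega : openset R d) :
    {pred 'rV[R]_d -> R[i]^o} :=
  fun f => `[< [/\ smooth Omega f, compact (supp f) & supp f `<=` Omega] >].

Section TestFunctions.
Context {R : realType} {d : nat} (Omega : openset R d).
Local Notation E := 'rV[R]_d.

Lemma is_testP (f : E -> R[i]^o) (K : set E) : smooth Omega f -> compact K ->
  K `<=` Omega -> (forall x, ~ K x -> f x = 0) -> is_test Omega f.
Proof.
move=> sf cK KO fK; have clK := compact_closed (@norm_hausdorff _ _) cK.
have fsub := sub_supp clK fK; apply/asboolP; split=> //.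
- by apply: (subclosed_compact _ cK fsub); apply: closed_closure.
- exact: subset_trans fsub KO.
Qed.

Lemma is_test_submod : submod_closed (is_test Omega).
Proof.
split=> [|a f g /asboolP[sf cf fO] /asboolP[sg cg gO]].
  apply: (is_testP (K := set0)) => //; [exact: smooth_cst|exact: compact0].
apply: (is_testP (K := supp f `|` supp g)).
- exact: (smoothD (smoothM (smooth_cst Omega a) sf) sg).
- exact: compactU.
- by move=> x [/fO|/gO].
- move=> x /not_orP[/supp_eq0 fx /supp_eq0 gx].
  by transitivity (a * f x + g x) => //; rewrite fx gx mulr0 addr0.
Qed.

HB.instance Definition _ := GRing.isSubmodClosed.Build R[i] (E -> R[i]^o)
  (is_test Omega) is_test_submod.

Record testfun := TestFun {
  testfun_val :> E -> R[i]^o;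
  testfunP : testfun_val \in is_test Omega }.

HB.instance Definition _ := [isSub for testfun_val].
HB.instance Definition _ := [Choice of testfun by <:].
HB.instance Definition _ := [SubChoice_isSubLmodule of testfun by <:].

Lemma testfun_smooth (phi : testfun) : smooth Omega phi.
Proof. by case: phi => phi /= /asboolP[]. Qed.

Lemma testfun_compact (phi : testfun) : compact (supp phi).
Proof. by case: phi => phi /= /asboolP[]. Qed.

Lemma testfun_supp (phi : testfun) : supp phi `<=` Omega.
Proof. by case: phi => phi /= /asboolP[]. Qed.

Lemma testfun_eqP (phi psi : testfun) :
  (forall x, phi x = psi x) -> phi = psi.
Proof. by move=> pq; apply/val_inj/funext. Qed.

Lemma test_mul_subproof (f : smoothfun Omega) (phi : testfun) :
  (fun x => f x * phi x : R[i]^o) \in is_test Omega.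
Proof.
apply: (is_testP (K := supp phi)).
- exact: smoothM (smoothfunP f) (testfun_smooth phi).
- exact: testfun_compact.
- exact: testfun_supp.
- by move=> x /supp_eq0 ->; rewrite mulr0.
Qed.

Lemma test_pderiv_subproof (i : 'I_d) (phi : testfun) :
  (pderiv i phi : E -> R[i]^o) \in is_test Omega.
Proof.
apply: (is_testP (K := supp phi)).
- exact: smooth_pderiv (testfun_smooth phi).
- exact: testfun_compact.
- exact: testfun_supp.
- by move=> x /pderiv_notin_supp ->.
Qed.

Definition test_mul (f : smoothfun Omega) (phi : testfun) : testfun :=
  TestFun (test_mul_subproof f phi).

Definition test_pderiv (i : 'I_d) (phi : testfun) : testfun :=
  TestFun (test_pderiv_subproof i phi).

(* Partial derivatives of smooth functions commute, so the order in which the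
   coordinates are enumerated is immaterial. *)
Definition test_deriv (alpha : 'I_d -> nat) (phi : testfun) : testfun :=
  foldr (fun i psi => iter (alpha i) (test_pderiv i) psi) phi (enum 'I_d).

Lemma test_mul_is_linear f : linear (test_mul f).
Proof.
move=> a phi psi; apply: testfun_eqP => x.
transitivity (f x * (a * phi x + psi x)) => //.
by rewrite mulrDr mulrCA.
Qed.

HB.instance Definition _ f :=
  GRing.isLinear.Build R[i] testfun testfun *:%R (test_mul f)
    (test_mul_is_linear f).

Lemma test_pderiv_is_linear i : linear (test_pderiv i).
Proof.
move=> a phi psi; apply: testfun_eqP => x.
have [Ox|nOx] := pselect (oset Omega x); last first.
  have n0 (chi : testfun) : pderiv i chi x = 0.
    by apply: pderiv_notin_supp => /testfun_supp.
  transitivity (0 : R[i]); first exact: n0.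
  transitivity (a * pderiv i phi x + pderiv i psi x) => //.
  by rewrite !n0 mulr0 addr0.
have [f1 f2] := smooth_derivable i (testfun_smooth phi) Ox.
have [g1 g2] := smooth_derivable i (testfun_smooth psi) Ox.
transitivity (pderiv i (fun y => a * phi y + psi y) x) => //.
transitivity (a * pderiv i phi x + pderiv i psi x) => //.
exact: pderiv_linear.
Qed.

HB.instance Definition _ i :=
  GRing.isLinear.Build R[i] testfun testfun *:%R (test_pderiv i)
    (test_pderiv_is_linear i).

Lemma test_deriv_is_linear alpha : linear (test_deriv alpha).
Proof.
move=> a phi psi; rewrite /test_deriv.
elim: (enum _) => //= i s ->.
by elim: (alpha i) => //= n ->; rewrite linearP.
Qed.

HB.instance Definition _ alpha :=
  GRing.isLinear.Build R[i] testfun testfun *:%R (test_deriv alpha)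
    (test_deriv_is_linear alpha).

End TestFunctions.

Definition multi_order {d : nat} (alpha : 'I_d -> nat) : nat := \sum_i alpha i.

(* The multi-indices alpha with |alpha| <= m, as a finite type: their entries
   are automatically at most m. *)
Record mindex (d m : nat) := MIndex {
  mindex_val : {ffun 'I_d -> 'I_m.+1};
  mindexP : (multi_order (fun i => mindex_val i) <= m)%N }.

HB.instance Definition _ d m := [isSub for @mindex_val d m].
HB.instance Definition _ d m := [Finite of mindex d m by <:].

Definition mindex_fun d m (alpha : mindex d m) : 'I_d -> nat :=
  fun i => mindex_val alpha i.
Coercion mindex_fun : mindex >-> Funclass.

Section DifferentialOperators.
Context {R : realType} {d : nat} {Omega : openset R d}.
Implicit Types T U : dual (testfun Omega).

Definition dual_mul (f : smoothfun Omega) T : dual (testfun Omega) :=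
  T \o test_mul f.

Definition dual_deriv (alpha : 'I_d -> nat) T : dual (testfun Omega) :=
  (-1) ^+ multi_order alpha *: (T \o test_deriv alpha : dual (testfun Omega)).

Definition pdo m (c : mindex d m -> smoothfun Omega) T : dual (testfun Omega) :=
  \sum_(alpha : mindex d m) dual_mul (c alpha) (dual_deriv alpha T).

Lemma dual_mul_is_linear f : linear (dual_mul f).
Proof. by move=> a S T; apply: dualP. Qed.

HB.instance Definition _ f :=
  GRing.isLinear.Build R[i] (dual (testfun Omega)) (dual (testfun Omega)) *:%R
    (dual_mul f) (dual_mul_is_linear f).

Lemma dual_deriv_is_linear alpha : linear (dual_deriv alpha).
Proof.
move=> a S T; apply: dualP => phi.
transitivity ((-1) ^+ multi_order alpha * (a * S (test_deriv alpha phi) +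
  T (test_deriv alpha phi))) => //.
by rewrite mulrDr mulrCA.
Qed.

HB.instance Definition _ alpha :=
  GRing.isLinear.Build R[i] (dual (testfun Omega)) (dual (testfun Omega)) *:%R
    (dual_deriv alpha) (dual_deriv_is_linear alpha).

Lemma pdo_is_linear m (c : mindex d m -> smoothfun Omega) : linear (pdo c).
Proof.
move=> a S T; rewrite /pdo scaler_sumr -big_split; apply: eq_bigr => alpha _.
by rewrite !linearP.
Qed.

HB.instance Definition _ m (c : mindex d m -> smoothfun Omega) :=
  GRing.isLinear.Build R[i] (dual (testfun Omega)) (dual (testfun Omega)) *:%R
    (pdo c) (pdo_is_linear c).

End DifferentialOperators.

(* Main.v *)
(* If [P^* = (- \o O)] with [O] injective, choose by Zorn a complement of the
   range of [O]; projecting along it gives a linear left inverse [L] of [O], and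
   [U = T \o L] solves the equation, since [U \o O = T \o L \o O = T]. *)
Require Import Defs.
From mathcomp Require Import all_boot all_algebra complex reals.
From HB Require Import structures.
From mathcomp Require Import boolp classical_sets.

Set Implicit Arguments.
Unset Strict Implicit.
Unset Printing Implicit Defensive.

Import GRing.Theory.

Local Open Scope classical_set_scope.
Local Open Scope ring_scope.

Section LinearLeftInverse.
Context {K : fieldType} {V W : lmodType K} (f : {linear V -> W}).
Context (f_inj : injective f).

(* The empty set is allowed, as Zorn's lemma includes the empty chain. *)
Let transverse (A : set W) : Prop :=
  (forall a x y, A x -> A y -> A (a *: x + y)) /\
  (forall v, A (f v) -> v = 0).

(** A maximal transverse [A] works: a vector [w] outside [A] plus the range of [f] could be adjoined
    to [A]. *)
Lemma range_complement : exists A : set W,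
  [/\ A 0, forall a x y, A x -> A y -> A (a *: x + y),
      forall v, A (f v) -> v = 0 & forall w, exists v, A (w - f v)].
Proof.
have [F FP Ftot|A [[Alin Atr] Amax]] := @Zorn_bigcup W transverse.
  split=> [a x y [X FX Xx] [Y FY Yy]|v [X FX]]; last exact: (FP _ FX).2.
  have [XY|YX] := Ftot _ _ FX FY.
  - by exists Y => //; apply: (FP _ FY).1 => //; apply: XY.
  - by exists X => //; apply: (FP _ FX).1 => //; apply: YX.
have A0 : A 0.
  (* Without 0, [A] would be empty, hence strictly inside [[set 0]], which is transverse as [f] is
     injective. *)
  apply: contrapT => nA0; apply: (Amax [set 0]).
    have Ae x : ~ A x.
      by move=> Ax; apply: nA0; have := Alin (-1) _ _ Ax Ax; rewrite scaleN1r addNr.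
    by split=> [x /Ae //|/(_ 0 erefl) /Ae].
  split=> [a x y -> ->|v /= fv0]; first by rewrite scaler0 addr0.
  by apply: f_inj; rewrite fv0 linear0.
exists A; split=> // w; apply: contrapT => nw.
(* [B] strictly extends [A]: by [nw] with witness 0, [w] is not in [A]. *)
pose B : set W := [set x | exists a y, A y /\ x = a *: w + y].
apply: (Amax B).
  split=> [x Ax|BA]; first by exists 0, x; split=> //; rewrite scale0r add0r.
  apply: nw; exists 0; rewrite linear0 subr0; apply: BA.
  by exists 1, 0; rewrite scale1r addr0.
split=> [a x y [b [x' [Ax ->]]] [c [y' [Ay ->]]]|v [a [y [Ay fvE]]]].
  exists (a * b + c), (a *: x' + y'); split; first exact: Alin.
  by rewrite scalerDr scalerA addrACA -scalerDl.
have [a0|a0] := eqVneq a 0.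
  by apply: Atr; rewrite fvE a0 scale0r add0r.
(* Solving [f v = a *: w + y] for [w] puts [w] in the range of [f] modulo [A]. *)
case: nw; exists (a^-1 *: v).
have -> : w - f (a^-1 *: v) = - a^-1 *: y + 0.
  rewrite linearZ /= fvE scalerDr scalerA mulVf// scale1r.
  by rewrite opprD addNKr addr0 scaleNr.
exact: Alin.
Qed.

(** [g w] is the coordinate of [w] along the range of [f], modulo the complement [A]. *)
Lemma linear_left_inverse : exists g : {linear W -> V}, cancel f g.
Proof.
have [A [A0 Alin Atr /choice[g gP]]] := range_complement.
(* This uniqueness makes the chosen [g] linear: two candidates differ by a vector whose image under
   [f] lies in [A]. *)
have gE w v : A (w - f v) -> g w = v.
  move=> Awv; apply/subr0_eq/Atr; rewrite linearB.
  have := Alin (-1) _ _ (gP w) Awv; rewrite scaleN1r.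
  by rewrite opprB addrA subrK.
have glin : linear g.
  move=> a x y; apply: gE; rewrite linearP opprD addrACA -scalerBr.
  exact: Alin.
exists (HB.pack_for {linear W -> V} g (GRing.isLinear.Build K W V *:%R g glin)).
by move=> v; apply: gE; rewrite subrr.
Qed.

End LinearLeftInverse.

Theorem theorem8p4 (R : realType) (d : nat) (Omega : openset R d) (m : nat)
    (c : mindex d m -> smoothfun Omega) :
  regular (pdo c) ->
  forall T : dual (testfun Omega),
    exists U : dual (testfun Omega), pdo c U = T.
Proof.
move=> [O O_inj pdoE] T; have [L OK] := linear_left_inverse O_inj.
exists (T \o L : dual (testfun Omega)); rewrite pdoE.
by apply: dualP => phi /=; rewrite OK.
Qed.
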